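(* Let $m\ge 2$ and let $K\ne\Delta_{[m]}$ be a simplicial complex on $[m]$. Then (a) $m-1\le\chi(\mathrm{Bier}(K))\le m$; and (b) $\chi(\mathrm{Bier}(K))=m-1$ if and only if $\mathrm{Bier}(K)$ is polytopal and either $P_K$ is combinatorially equivalent to the cube $I^{m-1}$, or $m\ge 3$ and $P_K$ is combinatorially equivalent to $I^{m-3}\times P_6$, where $P_6$ is a hexagon.
   Context: A simplicial complex $K$ on $[m]=\{1,\dots,m\}$ is a nonempty family of subsets of $[m]$ closed under taking subsets; $V(K)=\{i:\{i\}\in K\}$. $\Delta_{[m]}=2^{[m]}$. Let $[m']=\{1',\dots,m'\}$ be a disjoint copy of $[m]$, $I'=\{i':i\in I\}$. For $K\ne\Delta_{[m]}$ the Alexander dual $K^\vee$ is the complex on $[m']$ with $J'\in K^\vee$ iff $[m]\setminus J\notin K$. The Bier sphere $\mathrm{Bier}(K)$ is the complex on $[m]\sqcup[m']$ with faces $I\sqcup J'$, $I\in K$, $J'\in K^\vee$, $I\cap J=\varnothing$; it is an $(m-2)$-dimensional PL sphere. The chromatic number $\chi(L)$ is the least number of colors in a map $c\colon V(L)\to C$ with $c(u)\ne c(v)$ whenever $\{u,v\}\in L$. $\mathrm{Bier}(K)$ is polytopal if it is simplicially isomorphic to the boundary complex of a convex simplicial polytope; in that case $P_K$ denotes a simple $(m-1)$-polytope whose dual $P_K^*$ has boundary complex isomorphic to $\mathrm{Bier}(K)$ (equivalently, the nerve complex of facets of $P_K$ is $\mathrm{Bier}(K)$). $I^n$ is the $n$-dimensional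 cube ($I^0$ a point). *)

(* Defs.v *)
From HB Require Import structures.
From mathcomp Require Import all_boot all_order all_algebra.
From mathcomp Require Import boolp.
From mathcomp Require Import Rstruct.
From Stdlib Require Rdefinitions.
Notation R := Rdefinitions.R.

Set Implicit Arguments.
Unset Strict Implicit.
Unset Printing Implicit Defensive.

Import Order.TTheory GRing.Theory Num.Theory.

Section Complexes.
Variable T : finType.

Definition is_complex (K : {set {set T}}) : bool :=
  (K != set0) &&
  [forall S in K, forall U : {set T}, (U \subset S) ==> (U \in K)].

Definition verts (K : {set {set T}}) : {set T} := [set v | [set v] \in K].

Definition colorable (K : {set {set T}}) (k : nat) : bool :=
  [exists c : {ffun T -> 'I_k},
     [forall u, forall v, ((u != v) && ([set u; v] \in K)) ==> (c u != c v)]].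

Lemma colorable_ex (K : {set {set T}}) : exists k, colorable K k.
Proof.
exists #|T|; apply/existsP; exists [ffun x => enum_rank x].
apply/forallP=> u; apply/forallP=> v; apply/implyP=> /andP[uv _].
by rewrite !ffunE (inj_eq enum_rank_inj).
Qed.

Definition chi (K : {set {set T}}) : nat := ex_minn (colorable_ex K).

End Complexes.

Definition simp_iso (T1 T2 : finType) (L1 : {set {set T1}}) (L2 : {set {set T2}}) : Prop :=
  exists f : T1 -> T2,
    [/\ {in verts L1 &, injective f},
        f @: verts L1 = verts L2 &
        forall S : {set T1}, S \subset verts L1 -> (S \in L1 <-> f @: S \in L2)].

(* [m] is 'I_m ; [m'] is the second copy, realised via inr in 'I_m + 'I_m *)
Definition alex_dual (m : nat) (K : {set {set 'I_m}}) : {set {set 'I_m}} :=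
  [set J : {set 'I_m} | ~: J \notin K].

Definition bier (m : nat) (K : {set {set 'I_m}}) : {set {set ('I_m + 'I_m)}} :=
  [set S : {set ('I_m + 'I_m)} |
     [&& [set i | inl i \in S] \in K,
         [set j | inr j \in S] \in alex_dual K &
         [disjoint [set i | inl i \in S] & [set j | inr j \in S]]]].

Definition dotR (d : nat) (a x : 'I_d -> R) : R := (\sum_(i < d) a i * x i)%R.

(* L is polytopal: there are points p v in R^d (v in V(L)) such that the vertex
   sets of the proper faces of conv{p v} (faces cut out by supporting
   hyperplanes a.x = b with a.x <= b on the polytope) are exactly the faces of L,
   v |-> p v being the simplicial isomorphism onto the boundary complex. *)
Definition polytopal (T : finType) (L : {set {set T}}) : Prop :=
  exists (d : nat) (p : T -> 'I_d -> R),
    forall S : {set T}, S \subset verts L ->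
      (S \in L <->
       (S != verts L /\
        exists (a : 'I_d -> R) (b : R),
          forall v, v \in verts L ->
            (v \in S -> dotR a (p v) = b) /\ (v \notin S -> (dotR a (p v) < b)%R))).

(* cube I^n = [0,1]^n ; facets F_(i,e) = {x_i = e}, e in {0,1} *)
Definition in_cube (n : nat) (x : 'I_n -> R) : Prop :=
  forall i, (0 <= x i <= 1)%R.

Definition cube_nerve (n : nat) : {set {set ('I_n * bool)}} :=
  [set S : {set ('I_n * bool)} |
     `[< exists x : 'I_n -> R, in_cube x /\
           forall ie, ie \in S -> x ie.1 = (ie.2)%:R%R >] ].

(* hexagon P_6 = {y in R^2 | hexform k y <= 1 for k < 6}, with vertices
   (1,0),(1,1),(0,1),(-1,0),(-1,-1),(0,-1); its facets (edges) are hexform k y = 1 *)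
Definition hexform (k : 'I_6) (y : 'I_2 -> R) : R :=
  let y0 := y ord0 in let y1 := y (Ordinal (isT : 1 < 2)) in
  match val k with
  | 0 => y0 | 1 => y1 | 2 => (- y0)%R | 3 => (- y1)%R
  | 4 => (y0 - y1)%R | _ => (y1 - y0)%R
  end.

Definition in_hex (y : 'I_2 -> R) : Prop := forall k, (hexform k y <= 1)%R.

(* facets of I^n x P_6: F_(i,e) x P_6 (inl) and I^n x E_k (inr) *)
Definition cubehex_nerve (n : nat) : {set {set (('I_n * bool) + 'I_6)}} :=
  [set S : {set (('I_n * bool) + 'I_6)} |
     `[< exists (x : 'I_n -> R) (y : 'I_2 -> R), [/\ in_cube x, in_hex y,
           (forall ie, inl ie \in S -> x ie.1 = (ie.2)%:R%R) &
           (forall k, inr k \in S -> hexform k y = 1%R)] >] ].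

(* Main.v *)
Require Import Defs.
From HB Require Import structures.
From mathcomp Require Import all_boot all_order all_algebra.
From mathcomp Require Import boolp Rstruct.
From mathcomp Require Import lra.

Set Implicit Arguments.
Unset Strict Implicit.
Unset Printing Implicit Defensive.

Import Order.TTheory GRing.Theory Num.Theory.

(** Every facet of Bier(K) has m - 1 vertices, so a colouring [c] with m - 1
    colours uses each colour once on each facet, and two facets sharing all but
    one vertex have equally coloured remaining vertices. Applied around a maximal
    face F of K this gives c(j') = c(k') for all j, k outside F; since j' and k'
    are adjacent as soon as the complement of {j, k} is not in K, at most two
    elements lie outside F. Dually, a minimal nonface N has at most two elements,
    and c(j) = c(k) for j, k in N. These two facts leave four families for K: the
    faces are the sets avoiding one point, avoiding two points, not containing a
    given pair, or meeting a given triple in at most one point. In each case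
    Bier(K) is a flag complex, and its pairs of antipodal vertices identify it
    with the nerve of the cube (first three families) or of the product of a cube
    and a hexagon (the last one). *)

(** * Colourings *)

Section Colorings.
Variables (T : finType) (L : {set {set T}}).

Definition proper_coloring (C : Type) (c : T -> C) :=
  forall u v S, S \in L -> u \in S -> v \in S -> u != v -> c u <> c v.

Hypothesis Lsub : forall S U : {set T}, S \in L -> U \subset S -> U \in L.

Lemma colorableP k : colorable L k <-> exists c : T -> 'I_k, proper_coloring c.
Proof.
split=> [/existsP[c /forallP cP]|[c cP]].
  exists c => u v S SL uS vS uv; apply/eqP.
  have /forallP/(_ v)/implyP := cP u; apply; rewrite uv /=.
  by apply: Lsub SL _; rewrite subUset !sub1set uS vS.
apply/existsP; exists [ffun x => c x].
apply/forallP=> u; apply/forallP=> v; apply/implyP=> /andP[uv uvL].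
by rewrite !ffunE; apply/eqP; apply: (cP u v _ uvL) => //; rewrite !inE eqxx ?orbT.
Qed.

Lemma colorable_card k S : colorable L k -> S \in L -> #|S| <= k.
Proof.
move=> /colorableP[c cP] SL; rewrite -(card_ord k) -(@card_in_imset _ _ c).
  exact: max_card.
move=> u v uS vS; case: (eqVneq u v) => // uv cuv.
by case: (cP u v S SL uS vS uv).
Qed.

(** The k vertices of [u |: X] carry all k colours, so [c v] occurs among them; it cannot occur on
    [X], whose points are all adjacent to [v]. *)
Lemma proper_exchange k (c : T -> 'I_k) (X : {set T}) u v : proper_coloring c ->
  #|X|.+1 = k -> u \notin X -> v \notin X -> u |: X \in L -> v |: X \in L ->
  c u = c v.
Proof.
move=> cP Xk uX vX uL vL.
have inj : {in u |: X &, injective c}.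
  move=> x y xS yS; case: (eqVneq x y) => // xy cxy.
  by case: (cP x y _ uL xS yS xy).
have : c v \in c @: (u |: X).
  suff -> : c @: (u |: X) = [set: 'I_k] by rewrite inE.
  by apply/eqP; rewrite eqEcard subsetT /= cardsT card_ord card_in_imset // cardsU1 uX -Xk.
case/imsetP => x; rewrite !inE => /orP[/eqP-> //|xX cvx].
case: (cP v x _ vL) => //; rewrite ?inE ?eqxx ?xX ?orbT //.
by apply: contraNneq vX => ->.
Qed.

End Colorings.

Lemma chi_colorable (T : finType) (L : {set {set T}}) : colorable L (chi L).
Proof. by rewrite /chi; case: ex_minnP. Qed.

Lemma chi_min (T : finType) (L : {set {set T}}) k : colorable L k -> chi L <= k.
Proof. by rewrite /chi; case: ex_minnP => n _ H /H. Qed.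

Lemma simp_iso_colorable (T1 T2 : finType) (L1 : {set {set T1}}) (L2 : {set {set T2}}) k :
  (forall S U : {set T1}, S \in L1 -> U \subset S -> U \in L1) ->
  simp_iso L1 L2 -> colorable L2 k -> colorable L1 k.
Proof.
move=> sub1 [f [finj fim fP]] /existsP[c /forallP cP].
apply/existsP; exists [ffun x => c (f x)].
apply/forallP=> u; apply/forallP=> v; apply/implyP=> /andP[uv uvL].
have uV : u \in verts L1 by rewrite inE (sub1 _ _ uvL) // sub1set !inE eqxx.
have vV : v \in verts L1 by rewrite inE (sub1 _ _ uvL) // sub1set !inE eqxx orbT.
have /forallP/(_ (f v))/implyP := cP (f u); rewrite !ffunE; apply; apply/andP; split.
  by apply: contra_neq uv => /finj; apply.
have /fP : [set u; v] \subset verts L1 by rewrite subUset !sub1set uV vV.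
by rewrite imsetU1 imset_set1 => -[H _]; apply: H.
Qed.

Lemma polytopal_iso (T1 T2 : finType) (L1 : {set {set T1}}) (L2 : {set {set T2}}) :
  simp_iso L1 L2 -> polytopal L2 -> polytopal L1.
Proof.
move=> [f [finj fim fP]] [d [p pP]]; exists d, (p \o f) => S SV.
have fSV : f @: S \subset verts L2 by rewrite -fim imsetS.
rewrite fP // pP //.
have memf v : v \in verts L1 -> (f v \in f @: S) = (v \in S).
  move=> vV; apply/imsetP/idP => [[w wS /finj ->] //|vS]; last by exists v.
  by apply: (subsetP SV).
have -> : (f @: S != verts L2) = (S != verts L1).
  congr negb; apply/eqP/eqP => [E|->//].
  apply/eqP; rewrite eqEsubset SV; apply/subsetP => v vV.
  by rewrite -memf // E -fim imset_f.
split=> -[Sn [a [b H]]]; split=> //; exists a, b => v vV.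
  by rewrite -memf //; apply: H; rewrite -fim imset_f.
by move: vV; rewrite -fim => /imsetP[w wV ->]; rewrite memf //; apply: H.
Qed.

(** * Flag complexes *)

Section CliqueComplex.
Variable T : finType.

(* A non-reflexive [r] is allowed: the points with [~~ r v v] are not vertices. *)
Definition clique_complex (r : rel T) : {set {set T}} :=
  [set S : {set T} | [forall u in S, forall v in S, r u v]].

Lemma clique_complexP (r : rel T) (S : {set T}) :
  reflect {in S &, forall u v, r u v} (S \in clique_complex r).
Proof.
rewrite inE; apply: (iffP forall_inP) => [H u v uS vS|H u uS].
  by have /forall_inP := H u uS; apply.
by apply/forall_inP => v; apply: H.
Qed.

Lemma verts_clique (r : rel T) v : (v \in verts (clique_complex r)) = r v v.
Proof.
rewrite inE; apply/clique_complexP/idP => [H|H u w /set1P-> /set1P->] //.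
by apply: H; apply: set11.
Qed.

End CliqueComplex.

(** The map is given backwards because every point of [T2] is a vertex, while [T1] may contain ghost
    points; there the inverse of [g] takes the default value [x0]. *)
Lemma clique_complex_iso (T1 T2 : finType) (r1 : rel T1) (r2 : rel T2) (g : T2 -> T1) (x0 : T2) :
  injective g -> (forall v, r1 v v -> exists x, g x = v) ->
  (forall x y, r2 x y = r1 (g x) (g y)) -> reflexive r2 ->
  simp_iso (clique_complex r1) (clique_complex r2).
Proof.
move=> ginj gsurj gr r2refl.
pose f v := odflt x0 [pick x | g x == v].
have gK x : f (g x) = x.
  rewrite /f; case: pickP => [y /eqP/ginj //|/(_ x)]; by rewrite eqxx.
have fK v : v \in verts (clique_complex r1) -> g (f v) = v.
  by rewrite verts_clique => /gsurj[x <-]; rewrite gK.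
exists f; split.
- by move=> u v uV vV fuv; rewrite -(fK u) // fuv fK.
- apply/setP => x; rewrite verts_clique r2refl; apply/imsetP; exists (g x); last by rewrite gK.
  by rewrite verts_clique -gr r2refl.
move=> S SV; split=> /clique_complexP H; apply/clique_complexP.
  by move=> _ _ /imsetP[u uS ->] /imsetP[v vS ->]; rewrite gr !fK ?(subsetP SV) //; apply: H.
move=> u v uS vS; rewrite -(fK u) -1?(fK v) ?(subsetP SV) // -gr.
by apply: H; apply: imset_f.
Qed.

(** * Rainbow facets of the Bier sphere *)

Section Bier.
Variable m : nat.
Implicit Types (I J N : {set 'I_m}) (K : {set {set 'I_m}}).

Definition dsum I J : {set ('I_m + 'I_m)} :=
  [set x | match x with inl i => i \in I | inr j => j \in J end].

Lemma dsum_bier K I J :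
  (dsum I J \in bier K) = [&& I \in K, ~: J \notin K & [disjoint I & J]].
Proof.
rewrite inE.
have -> : [set i | inl i \in dsum I J] = I by apply/setP => i; rewrite !inE.
have -> : [set i | inr i \in dsum I J] = J by apply/setP => i; rewrite !inE.
by rewrite inE.
Qed.

Lemma card_dsum I J : #|dsum I J| = #|I| + #|J|.
Proof.
have -> : dsum I J = (inl @: I) :|: (inr @: J).
  apply/setP => -[i|i]; rewrite !inE mem_imset ?orbF //=; try by move=> ? ? [].
    by case: imsetP => [[x _ //]|]; rewrite orbF.
  by case: imsetP => [[x _ //]|].
rewrite cardsU !card_imset; try by move=> ? ? [].
suff -> : (inl @: I) :&: (inr @: J) = set0 :> {set 'I_m + 'I_m} by rewrite cards0 subn0.
by apply/setP => x; rewrite !inE; apply/andP => -[/imsetP[i _ ->] /imsetP[j _]].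
Qed.

Section Complex.
Variable K : {set {set 'I_m}}.
Hypothesis Kcx : is_complex K.

Lemma complex_sub I N : N \in K -> I \subset N -> I \in K.
Proof.
case/andP: Kcx => _ /forall_inP H /H /forallP/(_ I)/implyP; exact.
Qed.

Lemma complex0 : set0 \in K.
Proof.
case/andP: (Kcx) => /set0Pn[N NK] _; exact: (complex_sub NK (sub0set _)).
Qed.

Lemma bier_sub (S U : {set ('I_m + 'I_m)}) : S \in bier K -> U \subset S -> U \in bier K.
Proof.
rewrite !inE => /and3P[H1 H2 H3] /subsetP US; apply/and3P; split.
- by apply: complex_sub H1 _; apply/subsetP => i; rewrite !inE; apply: US.
- by apply: contra H2 => H2; apply: complex_sub H2 _; apply/subsetP => i; rewrite !inE; apply: contra; apply: US.
- apply: disjointWl (disjointWr _ H3); apply/subsetP => i; rewrite !inE; exact: US.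
Qed.

Hypothesis Knt : K != [set: {set 'I_m}].

Lemma complexT : [set: 'I_m] \notin K.
Proof.
apply: contra Knt => TK; apply/eqP/setP => I; rewrite [RHS]inE.
exact: complex_sub TK (subsetT _).
Qed.

Lemma max_face I : I \in K -> exists F : {set _}, [/\ I \subset F, F \in K &
  forall k, k \notin F -> k |: F \notin K].
Proof.
move=> IK; have [F /maxsetP[FK Fmax] IF] := maxset_exists (P := [pred F | F \in K]) IK.
exists F; split=> // k kF; apply: contra kF => kFK.
by rewrite -(Fmax _ kFK (subsetU1 _ _)) setU11.
Qed.

Lemma min_nonface N : N \notin K -> exists M : {set _}, [/\ M \subset N, M \notin K &
  forall k, k \in M -> M :\ k \in K].
Proof.
move=> NK; have [M /minsetP[/= MK Mmin] MN] := minset_exists (P := [pred F | F \notin K]) NK.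
exists M; split=> // k kM; apply: contraLR (kM) => kMK.
by rewrite -(Mmin _ kMK (subD1set _ _)) !inE eqxx.
Qed.

(** For a maximal face F and a point j outside it, take F together with the primed complement of F
    without j. The primed part is a dual face because F with j added is not in [K]. *)
Lemma bier_facet : exists2 S, S \in bier K & #|S| = m.-1.
Proof.
have [F [_ FK Fmax]] := max_face complex0.
have [j jF] : exists j, j \notin F.
  apply/existsP; rewrite -negb_forall; apply: contra complexT => /forallP H.
  by suff <- : F = setT by []; apply/setP => i; rewrite H inE.
exists (dsum F (~: F :\ j)).
  rewrite dsum_bier FK /=; apply/andP; split.
    by apply: contra (Fmax j jF) => H; apply: complex_sub H _; apply/subsetP => i; rewrite !inE negb_and !negbK.
  by rewrite -setI_eq0; apply/eqP/setP => i; rewrite !inE; case: (i \in F); rewrite ?andbF.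
by rewrite card_dsum -[m in RHS]card_ord -(cardsC F) (cardsD1 j (~: F)) inE jF addnS.
Qed.

Lemma chi_bier_ge : m.-1 <= chi (bier K).
Proof.
have [S SB <-] := bier_facet.
exact: (colorable_card bier_sub (chi_colorable _) SB).
Qed.

Lemma chi_bier_le : chi (bier K) <= m.
Proof.
apply: chi_min; apply/(colorableP bier_sub).
(* The colour forgets the copy: i and i' agree, and no face contains both. *)
exists (fun x => match x with inl i => i | inr i => i end).
move=> u v S; rewrite inE => /and3P[_ _ /pred0P D] uS vS uv E; move: uv uS vS.
case: u E => i; case: v => j ->; rewrite ?eqxx // => _ H1 H2;
  by have := D j; rewrite /= !inE H1 H2.
Qed.

(** * Consequences of a colouring with m - 1 colours *)

Variable c : ('I_m + 'I_m) -> 'I_m.-1.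
Hypothesis cP : proper_coloring (bier K) c.

Lemma edge_inr j k : j != k -> c (inr j) = c (inr k) -> ~: [set j; k] \in K.
Proof.
move=> jk E; apply/negPn/negP => H.
have SB : dsum set0 [set j; k] \in bier K.
  by rewrite dsum_bier complex0 H /= -setI_eq0 set0I.
by apply: (cP SB _ _ _ E); rewrite ?inE ?eqxx ?orbT.
Qed.

Lemma edge_inl j k : j != k -> c (inl j) = c (inl k) -> [set j; k] \notin K.
Proof.
move=> jk E; apply/negP => H.
have SB : dsum [set j; k] set0 \in bier K.
  by rewrite dsum_bier H setC0 complexT -setI_eq0 setI0 /=.
by apply: (cP SB _ _ _ E); rewrite ?inE ?eqxx ?orbT.
Qed.

Lemma cofacet_color F j k : F \in K -> j \notin F -> k \notin F -> j != k ->
  j |: F \notin K -> k |: F \notin K -> c (inr j) = c (inr k).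
Proof.
move=> FK jF kF jk jFK kFK.
(* Adding x' to the common part leaves out only y' over F, which is a dual face because [y |: F] is
   not in [K]. *)
have mem x y : x \notin F -> y \notin F -> x != y -> x |: F \notin K -> y |: F \notin K ->
    inr x |: dsum F (~: F :\: [set x; y]) \in bier K.
  move=> xF yF xy xFK yFK.
  suff -> : inr x |: dsum F (~: F :\: [set x; y]) = dsum F (~: F :\ y).
    rewrite dsum_bier FK /=; apply/andP; split.
      by apply: contra yFK => H; apply: complex_sub H _; apply/subsetP => i; rewrite !inE negb_and !negbK.
    by rewrite -setI_eq0; apply/eqP/setP => i; rewrite !inE; case: (i \in F); rewrite ?andbF.
  apply/setP => -[i|i]; rewrite !inE //.
  change (inr i == inr x) with (i == x).
  by case: (eqVneq i x) => [->|]; rewrite ?(negPf xy) ?xF.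
apply: (proper_exchange (X := dsum F (~: F :\: [set j; k])) cP).
- rewrite card_dsum -[m in RHS]card_ord -(cardsC F) (cardsD1 j (~: F)).
  rewrite (cardsD1 k (~: F :\ j)) !inE jF kF eq_sym jk /= !addnS.
  by rewrite setDDl.
- by rewrite !inE eqxx.
- by rewrite !inE eqxx orbT.
- exact: mem.
- by rewrite [[set j; k]]setUC; apply: mem; rewrite // eq_sym.
Qed.

(** Dual exchange: N without j and N without k, each joined with the primed complement of N, are
    facets that differ only in k and j. *)
Lemma nonface_color N j k : N \notin K -> j \in N -> k \in N -> j != k ->
  N :\ j \in K -> N :\ k \in K -> c (inl j) = c (inl k).
Proof.
move=> NK jN kN jk jNK kNK.
have mem x y : x \in N -> y \in N -> x != y -> N :\ y \in K ->
    inl x |: dsum (N :\: [set x; y]) (~: N) \in bier K.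
  move=> xN yN xy yNK.
  suff -> : inl x |: dsum (N :\: [set x; y]) (~: N) = dsum (N :\ y) (~: N).
    rewrite dsum_bier yNK setCK NK /=.
    by rewrite -setI_eq0; apply/eqP/setP => i; rewrite !inE; case: (i \in N); rewrite ?andbF.
  apply/setP => -[i|i]; rewrite !inE //.
  change (inl i == inl x) with (i == x).
  by case: (eqVneq i x) => [->|]; rewrite ?(negPf xy) ?xN.
apply: (proper_exchange (X := dsum (N :\: [set j; k]) (~: N)) cP).
- rewrite card_dsum -[m in RHS]card_ord -(cardsC N) (cardsD1 j N).
  rewrite (cardsD1 k (N :\ j)) !inE jN kN eq_sym jk /= !addSn.
  by rewrite setDDl.
- by rewrite !inE eqxx.
- by rewrite !inE eqxx orbT.
- exact: mem.
- by rewrite [[set j; k]]setUC; apply: mem; rewrite // eq_sym.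
Qed.

(** Enlarge I to a maximal face and choose j, k outside it; j = k covers the case where it misses a
    single point. *)
Lemma cofacet_pair I : I \in K -> exists j k,
  [/\ j \notin I, k \notin I, ~: [set j; k] \in K & c (inr j) = c (inr k)].
Proof.
move=> /max_face[F [IF FK Fmax]].
have [j jF] : exists j, j \notin F.
  apply/existsP; rewrite -negb_forall; apply: contra complexT => /forallP H.
  by suff <- : F = setT by []; apply/setP => i; rewrite H inE.
have nI x : x \notin F -> x \notin I by apply: contra => /(subsetP IF).
have [/existsP[k /andP[kF jk]]|/existsPn jonly] := boolP [exists k, (k \notin F) && (j != k)].
  have E := cofacet_color FK jF kF jk (Fmax j jF) (Fmax k kF).
  by exists j, k; rewrite !nI // E edge_inr.
exists j, j; rewrite nI //; split=> //; rewrite setUid.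
suff <- : F = ~: [set j] by [].
apply/setP => i; rewrite !inE; have := jonly i; rewrite negb_and !negbK (eq_sym j).
by case: (eqVneq i j) => [->|_]; rewrite ?(negPf jF) // orbF => ->.
Qed.

(** Shrink N to a minimal nonface, nonempty since the empty set is a face; j = k covers the case of
    a single ghost point. *)
Lemma nonface_pair N : N \notin K -> exists j k,
  [/\ j \in N, k \in N, [set j; k] \notin K & c (inl j) = c (inl k)].
Proof.
move=> /min_nonface[M [MN MK Mmin]].
have [j jM] : exists j, j \in M.
  by apply/set0Pn; apply: contraNneq MK => ->; exact: complex0.
have nI x : x \in M -> x \in N by move/(subsetP MN).
have [/existsP[k /andP[kM jk]]|/existsPn jonly] := boolP [exists k, (k \in M) && (j != k)].
  have E := nonface_color MK jM kM jk (Mmin j jM) (Mmin k kM).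
  by exists j, k; rewrite !nI // E edge_inl.
exists j, j; rewrite nI //; split=> //; rewrite setUid.
suff <- : M = [set j] by [].
apply/setP => i; rewrite !inE; have := jonly i; rewrite negb_and !negbK (eq_sym j).
by case: (eqVneq i j) => [->|_]; rewrite ?jM // orbF => /negPf.
Qed.

End Complex.
End Bier.

(** * Classification of the complexes *)

Definition at_most_one (T : finType) (a b c : T) (I : {set T}) : bool :=
  [&& ~~ ((a \in I) && (b \in I)), ~~ ((b \in I) && (c \in I)) & ~~ ((a \in I) && (c \in I))].

Section Classification.
(** From here on the sphere is seen only through [p] and [q], the colours of i and of i'. *)
Variables (T : finType) (C : Type) (K : {set {set T}}) (p q : T -> C).
Implicit Types I N F : {set T}.
Hypothesis Ksub : forall I N : {set T}, N \in K -> I \subset N -> I \in K.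
Hypothesis K0 : set0 \in K.
Hypothesis KT : setT \notin K.
Hypothesis pE : forall j k, j != k -> p j = p k -> [set j; k] \notin K.
Hypothesis qE : forall j k, j != k -> q j = q k -> ~: [set j; k] \in K.
Hypothesis cofaceE : forall I, I \in K -> exists j k,
  [/\ j \notin I, k \notin I, ~: [set j; k] \in K & q j = q k].
Hypothesis nonfaceE : forall N, N \notin K -> exists j k,
  [/\ j \in N, k \in N, [set j; k] \notin K & p j = p k].

Lemma cofaceP j k I : ~: [set j; k] \in K -> j \notin I -> k \notin I -> I \in K.
Proof.
move=> H jI kI; apply: Ksub H _; apply/subsetP => i iI; rewrite !inE negb_or.
by apply/andP; split; apply: contraTneq iI => ->.
Qed.

Lemma nonfaceP j k N : [set j; k] \notin K -> j \in N -> k \in N -> N \notin K.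
Proof.
by move=> H jN kN; apply: contra H => H; apply: Ksub H _; rewrite subUset !sub1set jN.
Qed.

Lemma p_face x y F : x != y -> p x = p y -> F \in K -> x \in F -> y \notin F.
Proof.
move=> xy pxy FK xF; apply: contraL FK => yF; exact: nonfaceP (pE xy pxy) xF yF.
Qed.

(** The pair {j, k} that [cofaceE] attaches to I has as complement a face containing I, hence
    avoiding y and z; as these are distinct, the two pairs coincide. *)
Lemma coface_two y z I : y != z -> I \in K ->
  (forall F, F \in K -> I \subset F -> (y \notin F) && (z \notin F)) ->
  ~: [set y; z] \in K /\ q y = q z.
Proof.
move=> yz /cofaceE[j [k [jI kI H qjk]]] /(_ _ H).
have -> : I \subset ~: [set j; k].
  apply/subsetP => i iI; rewrite !inE negb_or.
  by apply/andP; split; apply: contraTneq iI => ->.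
move=> /(_ isT); rewrite !inE !negbK => /andP[/orP[/eqP yj|/eqP yj] /orP[/eqP zj|/eqP zj]];
  subst; rewrite ?eqxx // in yz *; by rewrite setUC.
Qed.

Lemma classification_ghost z : [set z] \notin K ->
  (forall I, (I \in K) = (z \notin I)) \/
  (exists2 w, z != w & forall I, (I \in K) = (z \notin I) && (w \notin I)).
Proof.
move=> zK.
have zI I : I \in K -> z \notin I.
  by apply: contraL => zI; apply: (@nonfaceP z z); rewrite ?setUid.
have coface I : I \in K -> exists k, [/\ k \notin I, ~: [set z; k] \in K & q z = q k].
  case/cofaceE => j [k [jI kI H qjk]]; have := zI _ H.
  rewrite !inE negbK => /orP[/eqP E|/eqP E]; subst z; first by exists k.
  by exists j; rewrite setUC.
have [H1|H1] := boolP (~: [set z] \in K).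
  left=> I; apply/idP/idP => [/zI //|zI']; apply: (@cofaceP z z) => //; by rewrite setUid.
have [w [_ wK qzw]] := coface _ K0.
have zw : z != w by apply: contraNneq H1 => E; move: wK; rewrite -E setUid.
right; exists w => // I; apply/idP/andP => [IK|[z' w']]; last exact: cofaceP wK z' w'.
split; first exact: zI.
have [k [kI kK qzk]] := coface _ IK.
(* Since q w = q z = q k, if w and k differ then the complement of {w, k} is a face; z lies in no
   face, so k = z, contrary to [H1]. *)
case: (eqVneq w k) => [-> //|wk]; have /zI := qE wk (etrans (esym qzw) qzk).
rewrite !inE negbK (negPf zw) /= => /eqP E; subst k.
by move: kK; rewrite setUid (negPf H1).
Qed.

Lemma classification_triple a b c : (forall z, [set z] \in K) ->
  a != b -> b != c -> a != c -> p a = p b -> p b = p c ->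
  forall I, (I \in K) = at_most_one a b c I.
Proof.
move=> nogh ab bc ac pab pbc.
(* A face containing x avoids y and z, so [coface_two] applies to {x}. *)
have key x y z : x != y -> y != z -> x != z -> p x = p y -> p y = p z -> ~: [set y; z] \in K.
  move=> xy yz xz pxy pyz.
  have [] // := coface_two yz (nogh x) _ => F FK; rewrite sub1set => xF.
  by rewrite (p_face xy) // (p_face xz) // pxy.
have pac := etrans pab pbc.
have ba : b != a by rewrite eq_sym.
have ca : c != a by rewrite eq_sym.
have cb : c != b by rewrite eq_sym.
move=> I; rewrite /at_most_one; apply/idP/idP => [IK|].
  apply/and3P; split; apply/negP => /andP[uI]; apply/negP.
  - exact: p_face ab pab IK uI.
  - exact: p_face bc pbc IK uI.
  - exact: p_face ac pac IK uI.
(* A set with at most one of the three points misses two of them, so it lies in a complement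
   supplied by [key]. *)
have [aI|aI] := boolP (a \in I); have [bI|bI] := boolP (b \in I);
  have [cI|cI] := boolP (c \in I) => //= _.
- by apply: cofaceP (key a b c _ _ _ _ _) bI cI.
- by apply: cofaceP (key b a c _ _ _ _ _) aI cI.
- by apply: cofaceP (key c a b _ _ _ _ _) aI bI.
- by apply: cofaceP (key c a b _ _ _ _ _) aI bI.
Qed.

(** Every face omits a point of each pair. This forces [q] to match a and b with x and y in one of
    the two orders, and either order is contradictory. *)
Lemma no_disjoint_pairs a b x y : (forall z, [set z] \in K) ->
  a != b -> x != y -> p a = p b -> p x = p y ->
  x != a -> x != b -> y != a -> y != b -> False.
Proof.
move=> nogh ab xy pab pxy xa xb ya yb.
(* The matching makes {a, v} a face and {a, u} a nonface; the latter gives p a = p u = p v, so {a,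
   v} would be a nonface too. *)
have fin u v : u != v -> p u = p v -> u != a -> u != b -> v != a -> v != b ->
    q b = q u -> q a = q v -> False.
  move=> uv puv ua ub va vb qbu qav.
  have bu : b != u by rewrite eq_sym.
  have avK : [set a; v] \in K.
    by by apply: (cofaceP (qE bu qbu)); rewrite !inE negb_or ?ua ?uv // eq_sym ab eq_sym.
  (* Otherwise every face containing {a, u} avoids b and v, so q v = q b = q u, and the complement
     of {u, v} is a face containing a and b. *)
  have auK : [set a; u] \notin K.
    apply/negP => auK.
    have [] := @coface_two b v _ _ auK _; rewrite 1?eq_sym //.
      move=> F FK; rewrite subUset !sub1set => /andP[aF uF].
      by rewrite (p_face ab) // (p_face uv).
    move=> _ qbv; have := qE uv (etrans (esym qbu) qbv) => H.
    have := p_face ab pab H; rewrite !inE !negb_or ![a == _]eq_sym ![b == _]eq_sym.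
    by rewrite ua ub va vb /= => /(_ isT).
  have [j [k [ji ki jkK pjk]]] := nonfaceE auK.
  have jk : j != k by apply: contraNneq jkK => ->; rewrite setUid.
  have pau : p a = p u.
    move: ji ki jk pjk; rewrite !inE => /orP[]/eqP-> /orP[]/eqP->; by rewrite ?eqxx.
  have av : a != v by rewrite eq_sym.
  by move: (pE av (etrans pau puv)); rewrite avK.
(* The pair attached to {u} misses u, so its complement is a face with u and without w; that face
   also omits x or y. Hence the pair is w with x or y. *)
have one u w : u != w -> p u = p w -> x != u -> y != u -> x != w -> y != w -> q w = q x \/ q w = q y.
  move=> uw puw xu yu xw yw; have [j [k [ju ku H qjk]]] := cofaceE (nogh u).
  have := p_face uw puw H; rewrite !inE negb_or ![u == _]eq_sym -!in_set1 ju ku negbK.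
  move=> /(_ isT) wjk.
  have : (x \notin ~: [set j; k]) || (y \notin ~: [set j; k]).
    by rewrite -negb_and; apply/negP => /andP[xH]; apply/negP; exact: p_face xy pxy H xH.
  rewrite !inE !negbK in wjk *.
  case/orP: wjk => /eqP E; subst; rewrite ?(negPf xw) ?(negPf yw) /= ?orbF;
    by move=> /orP[]/eqP->; [left|right].
have ba : b != a by rewrite eq_sym.
have notab : q a <> q b.
  move=> qab; have := p_face xy pxy (qE ab qab); rewrite !inE !negb_or xa xb ya yb; by move/(_ isT).
have yx : y != x by rewrite eq_sym.
case: (one a b) => // [qb|qb]; case: (one b a) => // [qa|qa].
- by apply: notab; rewrite qa qb.
- exact: (fin x y).
- exact: (fin y x).
- by apply: notab; rewrite qa qb.
Qed.

Lemma classification :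
  [\/ exists z, forall I, (I \in K) = (z \notin I),
      exists z w, z != w /\ forall I, (I \in K) = (z \notin I) && (w \notin I),
      exists a b, a != b /\ forall I, (I \in K) = ~~ ((a \in I) && (b \in I)) |
      exists a b c, [/\ a != b, b != c, a != c & forall I, (I \in K) = at_most_one a b c I]].
Proof.
have [/existsP[z zK]|] := boolP [exists z, [set z] \notin K].
  by case: (classification_ghost zK) => [H|[w zw H]]; [apply: Or41; exists z|apply: Or42; exists z, w].
move=> /existsPn nogh0; have nogh z : [set z] \in K by have := nogh0 z; rewrite negbK.
have nonface N : N \notin K -> exists j k, [/\ j \in N, k \in N, j != k & p j = p k].
  move=> /nonfaceE[j [k [jN kN jkK pjk]]]; exists j, k; split=> //.
  by apply: contraNneq jkK => ->; rewrite setUid.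
have [a [b [_ _ ab pab]]] := nonface _ KT.
(* Either every nonface contains both a and b, or another pair {x, y} of equal colour exists:
   sharing a point with {a, b} it gives a triple, and disjoint from it it is impossible. *)
have [/forall_inP H|] := boolP [forall N in ~: K, (a \in N) && (b \in N)].
  apply: Or43; exists a, b; split=> // I; apply/idP/idP => [IK|].
    by apply/negP => /andP[aI]; apply/negP; exact: p_face ab pab IK aI.
  by apply: contraR => IK; apply: H; rewrite inE.
move=> /forall_inPn[N]; rewrite inE => /nonface[x [y [xN yN xy pxy]]] abN.
have triple c u v : u != v -> p u = p v -> u != c -> v != c -> p c = p u ->
    exists a b c, [/\ a != b, b != c, a != c & forall I, (I \in K) = at_most_one a b c I].
  move=> uv puv uc vc pcu; have cu : c != u by rewrite eq_sym.
  have cv : c != v by rewrite eq_sym.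
  by exists c, u, v; split=> //; apply: classification_triple.
apply: Or44.
have [xa|xa] := eqVneq x a.
  subst x; have ya : y != a by rewrite eq_sym.
  have yb : y != b by apply: contraNneq abN => <-; rewrite xN.
  by apply: (triple y a b ab pab); rewrite 1?eq_sym // -?pxy.
have [xb|xb] := eqVneq x b.
  subst x; have ya : y != a by apply: contraNneq abN => <-; rewrite xN yN.
  have yb : y != b by rewrite eq_sym.
  by apply: (triple y a b ab pab); rewrite 1?eq_sym // -?pxy ?pab.
have [ya|ya] := eqVneq y a.
  by subst y; apply: (triple x a b ab pab); rewrite 1?eq_sym.
have [yb|yb] := eqVneq y b.
  by subst y; apply: (triple x a b ab pab); rewrite 1?eq_sym // pxy ?pab.
by case: (@no_disjoint_pairs a b x y).
Qed.

End Classification.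

Lemma clique_complex_sub (T : finType) (r : rel T) (S U : {set T}) :
  S \in clique_complex r -> U \subset S -> U \in clique_complex r.
Proof.
move=> /clique_complexP H /subsetP US; apply/clique_complexP => u v /US uS /US vS; exact: H.
Qed.

(** * Nerves of the cube and of the cube times the hexagon *)

Definition cube_rel n : rel ('I_n * bool) := fun u v => (u.1 == v.1) ==> (u.2 == v.2).

(* The outer normals of the facets 4, 1, 2 of the hexagon sum to zero, and those
   of 5, 3, 0 are their opposites. Hence the facets are the six vectors with a
   coordinate in {0, 1, 2} and a sign, and two of them are adjacent exactly
   when both the coordinates and the signs differ. *)
Definition hex_coord (k : 'I_6) : nat :=
  match val k with 4 | 5 => 0 | 1 | 3 => 1 | _ => 2 end.
Definition hex_sign (k : 'I_6) : bool :=
  match val k with 4 | 1 | 2 => true | _ => false end.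
Definition hex_rel : rel 'I_6 := fun k l =>
  if hex_sign k == hex_sign l then hex_coord k == hex_coord l else hex_coord k != hex_coord l.

Definition cubehex_rel n : rel (('I_n * bool) + 'I_6) := fun u v =>
  match u, v with
  | inl ie, inl jf => cube_rel ie jf
  | inr k, inr l => hex_rel k l
  | _, _ => true
  end.

Lemma cube_rel_refl n : reflexive (@cube_rel n).
Proof. by move=> u; rewrite /cube_rel !eqxx. Qed.

Lemma cubehex_rel_refl n : reflexive (@cubehex_rel n).
Proof. by move=> [u|k] /=; rewrite ?cube_rel_refl // /hex_rel !eqxx. Qed.

Section Hexagon.
Local Open Scope ring_scope.

Lemma hexform_rel (y : 'I_2 -> R) k l :
  in_hex y -> hexform k y = 1 -> hexform l y = 1 -> hex_rel k l.
Proof.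
move=> yP; have := (yP (inord 0), yP (inord 1), yP (inord 2), yP (inord 3), yP (inord 4), yP (inord 5)).
rewrite /hexform /= !inordK // => -[[[[[h0 h1] h2] h3] h4] h5].
by case: k l => [[|[|[|[|[|[|]]]]]] //= Hk] [[|[|[|[|[|[|]]]]]] //= Hl]; rewrite /hex_rel //= => hk hl; exfalso; lra.
Qed.

(** The point y lies in the relative interior of the face cut out by [t]; strictness off [t] is what
    polytopality asks for. *)
Lemma hexform_face (t : {set 'I_6}) : t \in clique_complex hex_rel ->
  exists y : 'I_2 -> R, forall k, (k \in t -> hexform k y = 1) /\ (k \notin t -> hexform k y < 1).
Proof.
move=> /clique_complexP tP.
pose b i := inord i \in t.
have bE k : (k \in t) = b k by rewrite /b inord_val.
have bP i j : (i < 6)%N -> (j < 6)%N -> ~~ hex_rel (inord i) (inord j) -> ~~ (b i && b j).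
  by move=> _ _; apply: contra => /andP[bi bj]; exact: tP.
have [[b45 b13 b20] [[b41 b42 b12] [b53 b50 b30]]] :
  [/\ ~~ (b 4 && b 5), ~~ (b 1 && b 3) & ~~ (b 2 && b 0)] /\
  [/\ ~~ (b 4 && b 1), ~~ (b 4 && b 2) & ~~ (b 1 && b 2)] /\
  [/\ ~~ (b 5 && b 3), ~~ (b 5 && b 0) & ~~ (b 3 && b 0)].
  by do !split; apply: bP; rewrite // /hex_rel /hex_sign /hex_coord /= !inordK.
(* [w] is 1 or -1 on the coordinates used by [t]; the others are equal and make the sum 0. *)
pose w (p q : bool) : R := if p then 1 else if q then -1 else 0.
pose s := w (b 4) (b 5) + w (b 1) (b 3) + w (b 2) (b 0).
pose z (p q : bool) : R := if p || q then w p q else - s / 2.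
(* Facets 2 and 1 read -y0 and y1, which fixes y; facet 4 then reads the coordinate 0 because the
   three coordinates sum to 0. *)
exists (fun r => if r == ord0 then - z (b 2) (b 0) else z (b 1) (b 3)) => k.
rewrite bE /hexform /= /z /s /w {bE bP tP z s w}.
move: b45 b13 b20 b41 b42 b12 b53 b50 b30.
case: k => [[|[|[|[|[|[|]]]]]] //= Hk];
  case: (b 0); case: (b 1); case: (b 2); case: (b 3); case: (b 4); case: (b 5) => //= *;
  split=> // _; lra.
Qed.

End Hexagon.

Lemma cube_nerveE n : cube_nerve n = clique_complex (@cube_rel n).
Proof.
apply/setP => S; apply/idP/clique_complexP => [|SP]; rewrite inE.
  move=> /asboolP[x [_ xS]] [i e] [j f] uS vS; apply/implyP => /= /eqP ij; subst j.
  have := etrans (esym (xS _ uS)) (xS _ vS) => /=.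
  by case: e {uS}; case: f {vS} => //= H; exfalso; lra.
(* A vertex of the cube: coordinates left free by [S] become 0. *)
apply/asboolP; exists (fun i => ((i, true) \in S)%:R%R); split.
  by move=> i; case: (_ \in S) => /=; apply/andP; split; lra.
move=> [i [|]] iS /=; first by rewrite iS.
case: (boolP (_ \in S)) => // iT.
by have := SP _ _ iS iT; rewrite /cube_rel /= eqxx.
Qed.

Lemma cubehex_nerveE n : cubehex_nerve n = clique_complex (@cubehex_rel n).
Proof.
apply/setP => S; apply/idP/clique_complexP => [|SP]; rewrite inE.
  move=> /asboolP[x [y [_ yP xS yS]]] [[i e]|k] [[j f]|l] uS vS //=; last first.
    exact: hexform_rel yP (yS _ uS) (yS _ vS).
  apply/implyP => /= /eqP ij; subst j.
  have := etrans (esym (xS _ uS)) (xS _ vS) => /=.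
  by case: e {uS}; case: f {vS} => //= H; exfalso; lra.
have [|y yP] := @hexform_face [set k | inr k \in S].
  by apply/clique_complexP => k l; rewrite !inE => kS lS; exact: SP kS lS.
apply/asboolP; exists (fun i => (inl (i, true) \in S)%:R%R), y; split.
- by move=> i; case: (_ \in S) => /=; apply/andP; split; lra.
- move=> k; have [H1 H2] := yP k.
  by case: (boolP (k \in [set k | inr k \in S])) => [/H1->|/H2/ltW].
- move=> [i [|]] iS /=; first by rewrite iS.
  case: (boolP (_ \in S)) => // iT.
  by have := SP _ _ iS iT; rewrite /= /cube_rel /= eqxx.
- by move=> k kS; apply: (yP k).1; rewrite inE.
Qed.

(** One colour per coordinate: opposite facets never meet. *)
Lemma cube_colorable n : colorable (cube_nerve n) n.
Proof.
rewrite cube_nerveE; apply/(colorableP (@clique_complex_sub _ _)); exists fst.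
move=> [i e] [j f] S /clique_complexP SP uS vS; apply: contra_neq_not => /= ij; subst j.
by have := SP _ _ uS vS; rewrite /cube_rel /= eqxx => /eqP ->.
Qed.

(** Two further colours suffice because the signs alternate around the hexagon. *)
Lemma cubehex_colorable n : colorable (cubehex_nerve n) (n + 2).
Proof.
rewrite cubehex_nerveE; apply/(colorableP (@clique_complex_sub _ _)).
exists (fun u => match u with inl ie => lshift 2 ie.1
  | inr k => rshift n (if hex_sign k then ord0 else ord_max) end).
move=> [[i e]|k] [[j f]|l] S /clique_complexP SP uS vS; apply: contra_neq_not => /=.
- move=> /lshift_inj ij; subst j.
  by have := SP _ _ uS vS; rewrite /= /cube_rel /= eqxx => /eqP ->.
- by move/eqP; rewrite eq_lrshift.
- by move/eqP; rewrite eq_rlshift.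
- move=> /rshift_inj E; have := SP _ _ uS vS; rewrite /= /hex_rel.
  have -> : hex_sign k = hex_sign l by case: (hex_sign k) E; case: (hex_sign l).
  rewrite eqxx => /eqP E2; congr inr; apply: val_inj; move: E E2.
  rewrite /hex_sign /hex_coord.
  by case: k {uS} => [[|[|[|[|[|[|]]]]]] //= Hk]; case: l {vS} => [[|[|[|[|[|[|]]]]]] //= Hl].
Qed.

(** * Polytopality of the two nerves *)

Section Polytopal.
Local Open Scope ring_scope.

(* The [p v] are the outer facet normals of the polytope with nerve [L]. *)
Lemma antipodal_polytopal (T : finType) (L : {set {set T}}) d (p : T -> 'I_d -> R) (v0 : T) :
  (forall v, exists w, forall x, dotR x (p w) = - dotR x (p v)) ->
  verts L = setT ->
  (forall S : {set T}, S \in L -> exists x, forall v,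
    (v \in S -> dotR x (p v) = 1) /\ (v \notin S -> dotR x (p v) < 1)) ->
  (forall (S : {set T}) x, (forall v, dotR x (p v) <= 1) ->
    (forall v, v \in S -> dotR x (p v) = 1) -> S \in L) ->
  polytopal L.
Proof.
move=> popp VT H1 H2; exists d, p => S _; rewrite VT; split=> [/H1[x xP]|[ST [x [b xP]]]].
  split; last by exists x, 1 => v _; exact: xP.
  (* A facet and its antipode cannot both be tight, their values being opposite. *)
  apply/eqP => ST; have [w wv] := popp v0.
  have := (xP v0).1; have := (xP w).1; rewrite ST !inE wv => /(_ isT) e1 /(_ isT) e2; clear -e1 e2; lra.
have le v : dotR x (p v) <= b.
  have [e1 e2] := xP v (in_setT _); case: (boolP (v \in S)) => [/e1->//|/e2/ltW //].
(* For v outside [S], the value at v is below b and its opposite is at most b, so 0 < 2b. Then x can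
   be rescaled to level 1. *)
have b0 : 0 < b.
  rewrite ltNge; apply/negP => b0; case/negP: ST; apply/eqP/setP => v; rewrite [RHS]inE.
  apply/negPn/negP => vS; have [_ /(_ vS) lt] := xP v (in_setT _).
  by have [w wv] := popp v; have := le w; rewrite wv; lra.
have dotZ v : dotR (fun i => x i / b) (p v) = dotR x (p v) / b.
  by rewrite /dotR mulr_suml; apply: eq_bigr => i _; rewrite mulrAC.
apply: (H2 S (fun i => x i / b)) => v; rewrite dotZ.
  by rewrite ler_pdivrMr // mul1r.
by move=> vS; rewrite (xP v (in_setT _)).1 // divff // gt_eqF.
Qed.

(** The cube is taken as [-1,1]^n, centred at the origin, so that opposite facets have opposite
    normals and all lie at level 1. *)
Definition cube_normal n (u : 'I_n * bool) (k : 'I_n) : R :=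
  if k == u.1 then (if u.2 then 1 else -1) else 0.

Lemma dot_cube_normal n (x : 'I_n -> R) u :
  dotR x (cube_normal u) = if u.2 then x u.1 else - x u.1.
Proof.
rewrite /dotR (bigD1 u.1) //= big1 => [|i iu].
  by rewrite /cube_normal eqxx; case: u.2; rewrite ?mulrN mulr1 addr0.
by rewrite /cube_normal (negPf iu) mulr0.
Qed.

Lemma cube_exact_point n (S : {set 'I_n * bool}) : S \in clique_complex (@cube_rel n) ->
  exists x : 'I_n -> R, forall v,
    (v \in S -> dotR x (cube_normal v) = 1) /\ (v \notin S -> dotR x (cube_normal v) < 1).
Proof.
move=> /clique_complexP SP.
(* Free coordinates sit at 0, the middle of [-1,1], so that no facet outside [S] is tight. *)
exists (fun i => if (i, true) \in S then 1 else if (i, false) \in S then -1 else 0) => -[i e].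
rewrite dot_cube_normal /=.
have nb : (i, true) \in S -> (i, false) \in S -> False.
  by move=> iT iF; have := SP _ _ iT iF; rewrite /cube_rel /= eqxx.
case: e; move: nb; case: ((i, true) \in S); case: ((i, false) \in S) => //= nb; split=> // _; try lra;
  by exfalso; apply: nb.
Qed.

Lemma cube_tight_rel n (x : 'I_n -> R) u v :
  dotR x (cube_normal u) = 1 -> dotR x (cube_normal v) = 1 -> cube_rel u v.
Proof.
rewrite !dot_cube_normal /cube_rel; case: u v => [i e] [j f] /= h1 h2; apply/implyP => /eqP ij.
by subst j; move: h1 h2; case: e; case: f => //= h1 h2; exfalso; lra.
Qed.

Lemma cube_opp n (v : 'I_n * bool) : exists w, forall x, dotR x (cube_normal w) = - dotR x (cube_normal v).
Proof.
exists (v.1, ~~ v.2) => x; rewrite !dot_cube_normal /=; case: v.2 => //=; by rewrite opprK.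
Qed.

Lemma cube_polytopal n : (0 < n)%N -> polytopal (cube_nerve n).
Proof.
case: n => // n _; rewrite cube_nerveE.
apply: (antipodal_polytopal (p := @cube_normal n.+1)).
- exact: (ord0, true).
- exact: cube_opp.
- by apply/setP => v; rewrite verts_clique cube_rel_refl inE.
- exact: cube_exact_point.
- by move=> S x _ xS; apply/clique_complexP => u v /xS uS /xS vS; exact: cube_tight_rel uS vS.
Qed.

Definition glue n (x : 'I_n -> R) (y : 'I_2 -> R) (k : 'I_(n + 2)) : R :=
  match split k with inl i => x i | inr r => y r end.

Lemma glue_lshift n x y i : @glue n x y (lshift 2 i) = x i.
Proof. by rewrite /glue (unsplitK (inl i)). Qed.

Lemma glue_rshift n x y i : @glue n x y (rshift n i) = y i.
Proof. by rewrite /glue (unsplitK (inr i)). Qed.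

Lemma dot_glue n a x y : dotR a (@glue n x y) =
  dotR (fun i => a (lshift 2 i)) x + dotR (fun r => a (rshift n r)) y.
Proof.
by rewrite /dotR big_split_ord /=; congr (_ + _); apply: eq_bigr => i _;
  rewrite ?glue_lshift ?glue_rshift.
Qed.

Lemma dot0 d (a : 'I_d -> R) : dotR a (fun=> 0) = 0.
Proof. by rewrite /dotR big1 // => i _; rewrite mulr0. Qed.

(** The coefficients of the linear form [hexform k], read off at the unit vectors. *)
Definition hex_normal (k : 'I_6) (r : 'I_2) : R := hexform k (fun s => (s == r)%:R).

Lemma dot_hex_normal (y : 'I_2 -> R) k : dotR y (hex_normal k) = hexform k y.
Proof.
rewrite /dotR !big_ord_recl big_ord0 /hex_normal /hexform.
have -> : lift ord0 ord0 = Ordinal (isT : (1 < 2)%N) by apply: val_inj.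
by case: k => [[|[|[|[|[|[|]]]]]] //= Hk]; lra.
Qed.

(** A facet of a product has the normal of the factor's facet, padded with zeros. *)
Definition cubehex_normal n (u : ('I_n * bool) + 'I_6) : 'I_(n + 2) -> R :=
  match u with
  | inl ie => glue (cube_normal ie) (fun=> 0)
  | inr k => glue (fun=> 0) (hex_normal k)
  end.

Lemma dot_cubehex_normal n (a : 'I_(n + 2) -> R) u : dotR a (cubehex_normal u) =
  match u with
  | inl ie => dotR (fun i => a (lshift 2 i)) (cube_normal ie)
  | inr k => hexform k (fun r => a (rshift n r))
  end.
Proof. by case: u => [ie|k]; rewrite dot_glue dot0 ?addr0 ?add0r ?dot_hex_normal. Qed.

Lemma cubehex_polytopal n : polytopal (cubehex_nerve n).
Proof.
rewrite cubehex_nerveE; apply: (antipodal_polytopal (p := @cubehex_normal n)).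
- exact: (inr ord0).
- move=> [ie|k].
    have [w wP] := cube_opp ie; exists (inl w) => x; by rewrite !dot_cubehex_normal wP.
  (* Opposite edges of the hexagon are 0 and 2, 1 and 3, 4 and 5. *)
  exists (inr (inord (match val k with 0 => 2 | 1 => 3 | 2 => 0 | 3 => 1 | 4 => 5 | _ => 4 end))) => x.
  rewrite !dot_cubehex_normal /hexform /=.
  by case: k => [[|[|[|[|[|[|]]]]]] //= Hk]; rewrite inordK //=; lra.
- by apply/setP => v; rewrite verts_clique cubehex_rel_refl inE.
- move=> S /clique_complexP SP.
  have [|x xP] := @cube_exact_point n [set u | inl u \in S].
    by apply/clique_complexP => k l; rewrite !inE => kS lS; exact: SP kS lS.
  have [|y yP] := @hexform_face [set k | inr k \in S].
    by apply/clique_complexP => k l; rewrite !inE => kS lS; exact: SP kS lS.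
  exists (glue x y) => v; rewrite dot_cubehex_normal.
  have -> : (fun i => glue x y (lshift 2 i)) = x by apply: funext => i; rewrite glue_lshift.
  have -> : (fun i => glue x y (rshift n i)) = y by apply: funext => i; rewrite glue_rshift.
  by case: v => [u|k]; [have := xP u | have := yP k]; rewrite !inE.
- move=> S x xle xS; apply/clique_complexP => -[u|k] [v|l] //= /xS + /xS;
    rewrite !dot_cubehex_normal; first exact: cube_tight_rel.
  by apply: hexform_rel => j; have := xle (inr j); rewrite dot_cubehex_normal.
Qed.

End Polytopal.

(** * Identification of the Bier spheres *)

Lemma enum_set (T : finType) (A : {set T}) n : #|A| = n -> exists h : 'I_n -> T,
  [/\ injective h, forall i, h i \in A & forall x, x \in A -> exists i, h i = x].
Proof.
move=> An; exists (fun i => enum_val (cast_ord (esym An) i)); split.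
- by move=> i j /enum_val_inj/cast_ord_inj.
- by move=> i; exact: enum_valP.
- by move=> x xA; exists (cast_ord An (enum_rank_in xA x)); rewrite cast_ordK enum_rankK_in.
Qed.

Section BierIso.
Variable m : nat.
Implicit Types (I J : {set 'I_m}) (K : {set {set 'I_m}}).

Definition bier_rel (r r' : rel 'I_m) : rel ('I_m + 'I_m) := fun u v =>
  match u, v with
  | inl i, inl j => r i j
  | inr i, inr j => r' i j
  | inl i, inr j | inr i, inl j => i != j
  end.

(** Disjointness of I and J is itself a condition on pairs, so flagness of [K] and of its dual
    passes to the sphere. *)
Lemma bier_clique K r r' : K = clique_complex r -> alex_dual K = clique_complex r' ->
  bier K = clique_complex (bier_rel r r').
Proof.
move=> KE K'E; apply/setP => S; rewrite inE K'E {}KE.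
apply/and3P/clique_complexP => [[/clique_complexP H1 /clique_complexP H2 H3]|H].
  have D i : inl i \in S -> inr i \in S -> False.
    by move=> iS iS'; have /pred0P/(_ i) := H3; rewrite /= !inE iS iS'.
  move=> [i|i] [j|j] iS jS /=.
  - by apply: H1; rewrite inE.
  - by apply/eqP => ij; subst j; exact: D iS jS.
  - by apply/eqP => ij; subst j; exact: D jS iS.
  - by apply: H2; rewrite inE.
split.
- by apply/clique_complexP => i j; rewrite !inE; exact: H.
- by apply/clique_complexP => i j; rewrite !inE; exact: H.
- apply/pred0P => i; rewrite /= !inE; apply/negP => /andP[iS iS'].
  by have := H _ _ iS iS'; rewrite /= eqxx.
Qed.

Lemma enum_setC1 n (z : 'I_m) : n.+1 = m -> exists h : 'I_n -> 'I_m,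
  [/\ injective h, forall i, h i \in ~: [set z] & forall x, x \in ~: [set z] -> exists i, h i = x].
Proof.
move=> nm; apply: enum_set; apply: succn_inj.
by rewrite nm -[RHS]card_ord -(cardsC [set z]) cards1.
Qed.

(** The second argument is ignored: the relation fails at (z, z), which makes z a ghost point. *)
Definition avoid1 (z : 'I_m) : rel 'I_m := fun i _ => i != z.
Definition avoid2 (z w : 'I_m) : rel 'I_m := fun i _ => (i != z) && (i != w).
Definition notboth (z w : 'I_m) : rel 'I_m := fun i j =>
  ~~ ((i == z) && (j == w)) && ~~ ((i == w) && (j == z)).
Definition atmost1 (B : {set 'I_m}) : rel 'I_m := fun i j =>
  [|| i == j, i \notin B | j \notin B].

Lemma avoid1P z I : (I \in clique_complex (avoid1 z)) = (z \notin I).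
Proof.
apply/clique_complexP/idP => [H|zI i j iI _].
  by apply/negP => zI; have := H z z zI zI; rewrite /avoid1 eqxx.
by rewrite /avoid1; apply: contraNneq zI => <-.
Qed.

Lemma avoid2P z w I : (I \in clique_complex (avoid2 z w)) = (z \notin I) && (w \notin I).
Proof.
apply/clique_complexP/andP => [H|[zI wI] i j iI _].
  split; apply/negP => zI; have := H _ _ zI zI; by rewrite /avoid2 eqxx ?andbF.
by rewrite /avoid2; apply/andP; split; [apply: contraNneq zI | apply: contraNneq wI] => <-.
Qed.

Lemma notbothP z w I : (I \in clique_complex (notboth z w)) = ~~ ((z \in I) && (w \in I)).
Proof.
apply/clique_complexP/negP => [H /andP[zI wI]|H i j iI jI].
  by have := H _ _ zI wI; rewrite /notboth !eqxx.
by rewrite /notboth -negb_or; apply/negP => /orP[] /andP[/eqP ? /eqP ?]; subst; apply: H; apply/andP.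
Qed.

Lemma atmost1P a b c I : a != b -> b != c -> a != c ->
  (I \in clique_complex (atmost1 [set a; b; c])) =
  at_most_one a b c I.
Proof.
move=> ab bc ac; apply/clique_complexP/and3P => [H|[H1 H2 H3] i j iI jI].
  by split; apply/negP => /andP[iI jI]; have := H _ _ iI jI;
    rewrite /atmost1 !inE !eqxx ?orbT ?(negPf ab) ?(negPf bc) ?(negPf ac).
rewrite /atmost1 !inE; case: (eqVneq i j) => //= ij; rewrite -negb_and.
apply/negP => /andP[/orP[/orP[]|] /eqP ? /orP[/orP[]|] /eqP ?]; subst;
  by rewrite ?eqxx // in ij; move: H1 H2 H3; rewrite iI jI.
Qed.

(** Such a [K] is its own dual; z and z' are ghosts, and i, i' for the other i are the antipodal
    pairs. *)
Lemma bier_avoid1_iso K n z : n.+1 = m -> 0 < n -> (forall I, (I \in K) = (z \notin I)) ->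
  simp_iso (bier K) (cube_nerve n).
Proof.
move=> nm n0 KP; rewrite cube_nerveE (@bier_clique K (avoid1 z) (avoid1 z)); first last.
- by apply/setP => I; rewrite avoid1P inE KP inE negbK.
- by apply/setP => I; rewrite avoid1P KP.
have [h [hinj hA hsurj]] := enum_setC1 z nm.
have hz i : h i != z by have := hA i; rewrite !inE.
apply: (clique_complex_iso (g := fun u => if u.2 then inl (h u.1) else inr (h u.1))).
- exact: (Ordinal n0, true).
- by move=> [i [|]] [j [|]] //= [/hinj ->].
- move=> [k|k] /= kz.
    by have [i <-] := hsurj k ltac:(by rewrite !inE); exists (i, true).
  by have [i <-] := hsurj k ltac:(by rewrite !inE); exists (i, false).
- move=> [i [|]] [j [|]]; rewrite /cube_rel /avoid1 /= ?hz ?implybT // ?(inj_eq hinj) ?implybF //.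
- exact: cube_rel_refl.
Qed.

Definition in_copy (b : bool) (i : 'I_m) : 'I_m + 'I_m := if b then inl i else inr i.

Lemma bier_rel_copy r r' b i c j : bier_rel r r' (in_copy b i) (in_copy c j) =
  if b == c then (if b then r i j else r' i j) else i != j.
Proof. by case: b; case: c. Qed.

(* [z] and [w] in the copy [b] form one antipodal pair; the other pairs are
   [i], [i'] for [i] different from [z] and [w]. *)
Lemma antipodes_iso n b z w r r' : n.+1 = m -> z != w ->
  (if b then r else r') = notboth z w -> (if b then r' else r) = avoid2 z w ->
  simp_iso (clique_complex (bier_rel r r')) (clique_complex (@cube_rel n)).
Proof.
move=> nm zw E1 E2.
have [h [hinj hA hsurj]] := enum_setC1 w nm.
have hw i : (h i == w) = false by have := hA i; rewrite !inE => /negPf.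
have wh i : (w == h i) = false by rewrite eq_sym.
have [x0 hx0] := hsurj z ltac:(by rewrite !inE).
have hz i : (h i == z) = (i == x0) by rewrite -hx0 (inj_eq hinj).
have wz : (w == z) = false by rewrite eq_sym (negPf zw).
have brel i j c d : bier_rel r r' (in_copy c i) (in_copy d j) =
  if c == d then (if c == b then notboth z w i j else avoid2 z w i j) else i != j.
  by rewrite bier_rel_copy; move: E1 E2; case: b => /= -> ->; case: c; case: d.
have copyI c d i j : in_copy c i = in_copy d j -> c = d /\ i = j by case: c; case: d => //= -[].
have nbb c : (~~ c == c) = false by case: c.
have bnb c : (c == ~~ c) = false by case: c.
(* [h] enumerates the points other than w, so z indexes the exceptional pair; its partner is w in
   the same copy, both z and w being ghosts in the other copy. *)
pose g u := if u.2 then in_copy b (h u.1) else if h u.1 == z then in_copy b w else in_copy (~~ b) (h u.1).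
apply: (clique_complex_iso (g := g)).
- exact: (x0, true).
- move=> [i d] [j e]; rewrite /g /= !hz.
  have [->|ix] := eqVneq i x0; have [->|jx] := eqVneq j x0; case: d; case: e => //=;
    move=> /copyI[/eqP + /eqP]; rewrite ?hw ?wh ?nbb ?bnb ?(inj_eq hinj) // => _ /eqP E;
    first [by rewrite E | by rewrite E eqxx in ix | by rewrite -E eqxx in jx].
- move=> v; have {v}[c [k ->]] : exists c k, v = in_copy c k.
    by case: v => k; [exists true, k|exists false, k].
  rewrite brel eqxx.
  case: (eqVneq c b) => [-> _|cb].
    case: (eqVneq k w) => [->|kw]; first by exists (x0, false); rewrite /g /= hx0 eqxx.
    by have [i <-] := hsurj k ltac:(by rewrite !inE); exists (i, true).
  rewrite /avoid2 => /andP[kz kw].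
  have [i hi] := hsurj k ltac:(by rewrite !inE); exists (i, false).
  rewrite /g /= hi (negPf kz); congr in_copy; clear -cb; by case: c cb; case: b.
- move=> [i [|]] [j [|]]; rewrite /g /cube_rel /= ?hz ?implybT ?implybF.
  + by rewrite brel !eqxx /notboth !hw andbF.
  + case: (eqVneq j x0) => [->|jx]; rewrite brel ?eqxx ?bnb ?(inj_eq hinj) //.
    by rewrite /notboth hw !eqxx andbT hz andbT.
  + case: (eqVneq i x0) => [->|ix]; rewrite brel ?eqxx ?nbb ?(inj_eq hinj) //.
    by rewrite /notboth hw andbF eqxx hz eq_sym.
  + case: (eqVneq i x0) => [_|ix]; case: (eqVneq j x0) => [_|jx];
      rewrite brel ?eqxx ?bnb ?nbb /notboth /avoid2 ?hw ?wh ?wz ?hz ?(negPf ix) ?eqxx //.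
- exact: cube_rel_refl.
Qed.

(** The dual consists of the sets not containing both z and w, so the exceptional antipodal pair is
    z', w'. *)
Lemma bier_avoid2_iso K n z w : n.+1 = m -> z != w ->
  (forall I, (I \in K) = (z \notin I) && (w \notin I)) -> simp_iso (bier K) (cube_nerve n).
Proof.
move=> nm zw KP; rewrite cube_nerveE (@bier_clique K (avoid2 z w) (notboth z w)).
- exact: (@antipodes_iso n false z w).
- by apply/setP => I; rewrite avoid2P KP.
- by apply/setP => I; rewrite notbothP inE KP !inE !negbK.
Qed.

Lemma bier_notboth_iso K n z w : n.+1 = m -> z != w ->
  (forall I, (I \in K) = ~~ ((z \in I) && (w \in I))) -> simp_iso (bier K) (cube_nerve n).
Proof.
move=> nm zw KP; rewrite cube_nerveE (@bier_clique K (notboth z w) (avoid2 z w)).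
- exact: (@antipodes_iso n true z w).
- by apply/setP => I; rewrite notbothP KP.
- by apply/setP => I; rewrite avoid2P inE KP !inE negbK.
Qed.

(** [K] is self-dual: a set has at most one of the three points exactly when its complement has at
    least two. Both copies of the triple form the hexagon, and i, i' for the other i form the
    cube. *)
Lemma bier_atmost1_iso K a b c : a != b -> b != c -> a != c ->
  (forall I, (I \in K) = at_most_one a b c I) ->
  3 <= m /\ simp_iso (bier K) (cubehex_nerve (m - 3)).
Proof.
move=> ab bc ac KP; pose B := [set a; b; c].
have B3 : #|B| = 3.
  by rewrite /B setUC cardsU1 !inE negb_or ![c == _]eq_sym ac bc cards2 ab.
split; first by rewrite -[m in _ <= m]card_ord -B3 max_card.
rewrite cubehex_nerveE (@bier_clique K (atmost1 B) (atmost1 B)); first last.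
- apply/setP => I; rewrite atmost1P // inE KP /at_most_one !inE.
  by case: (a \in I); case: (b \in I); case: (c \in I).
- by apply/setP => I; rewrite atmost1P // KP.
have [h [hinj hA hsurj]] : exists h : 'I_(m - 3) -> 'I_m,
    [/\ injective h, forall i, h i \in ~: B & forall x, x \in ~: B -> exists i, h i = x].
  by apply: enum_set; rewrite cardsCs setCK card_ord B3.
have {}hA i : h i \notin B by have := hA i; rewrite inE.
pose s := [:: a; b; c].
have us : uniq s by rewrite /= !inE negb_or ab ac bc.
pose pt k := nth a s (hex_coord k).
have co3 k : hex_coord k < 3 by case: k => [[|[|[|[|[|[|]]]]]] //= Hk].
have ptE k l : (pt k == pt l) = (hex_coord k == hex_coord l) by rewrite nth_uniq.
have ptB k : pt k \in B.
  have : pt k \in s by rewrite mem_nth.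
  by rewrite !inE orbA.
have hpt i k : (h i == pt k) = false by apply/negP => /eqP E; have := hA i; rewrite E ptB.
have pth i k : (pt k == h i) = false by rewrite eq_sym.
pose g (u : ('I_(m - 3) * bool) + 'I_6) : 'I_m + 'I_m := match u with
  | inl ie => in_copy ie.2 (h ie.1)
  | inr k => in_copy (hex_sign k) (pt k)
  end.
have copyI d e i j : in_copy d i = in_copy e j -> d = e /\ i = j by case: d; case: e => //= -[].
have brel i j d e : bier_rel (atmost1 B) (atmost1 B) (in_copy d i) (in_copy e j) =
  if d == e then atmost1 B i j else i != j by case: d; case: e.
apply: (clique_complex_iso (g := g)).
- exact: (inr ord0).
- move=> [[i d]|k] [[j e]|l] /copyI[] /=.
  + by move=> -> /hinj ->.
  + by move=> _ /eqP; rewrite hpt.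
  + by move=> _ /eqP; rewrite pth.
  + move=> E /eqP; rewrite ptE => /eqP E2; congr inr; apply: val_inj; move: E E2.
    rewrite /hex_sign /hex_coord.
    by case: k => [[|[|[|[|[|[|]]]]]] //= Hk]; case: l => [[|[|[|[|[|[|]]]]]] //= Hl].
- move=> v _; have {v}[d [k ->]] : exists d k, v = in_copy d k.
    by case: v => k; [exists true, k|exists false, k].
  have [kB|kB] := boolP (k \in B).
    have : k \in s by move: kB; rewrite !inE orbA.
    (* The six indices invert the table of [hex_coord] and [hex_sign]. *)
    rewrite !inE => /or3P[] /eqP ->; case: d.
    * by exists (inr (inord 4)); rewrite /g /pt /hex_sign /hex_coord /= !inordK.
    * by exists (inr (inord 5)); rewrite /g /pt /hex_sign /hex_coord /= !inordK.
    * by exists (inr (inord 1)); rewrite /g /pt /hex_sign /hex_coord /= !inordK.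
    * by exists (inr (inord 3)); rewrite /g /pt /hex_sign /hex_coord /= !inordK.
    * by exists (inr (inord 2)); rewrite /g /pt /hex_sign /hex_coord /= !inordK.
    * by exists (inr (inord 0)); rewrite /g /pt /hex_sign /hex_coord /= !inordK.
  by have [i <-] := hsurj k ltac:(by rewrite inE); exists (inl (i, d)).
- move=> [[i d]|k] [[j e]|l]; rewrite /g brel /= /atmost1 ?hA ?hpt ?pth ?orbT ?if_same //=.
  + by rewrite /cube_rel /= (inj_eq hinj); case: (d == e); rewrite ?implybT ?implybF.
  + by rewrite ptE !ptB /= orbF.
- exact: cubehex_rel_refl.
Qed.

End BierIso.

Theorem mainTheorem11 (m : nat) (K : {set {set 'I_m}}) :
  2 <= m -> is_complex K -> K != [set: {set 'I_m}] ->
  (m.-1 <= chi (bier K) <= m) /\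
  (chi (bier K) = m.-1 <->
     polytopal (bier K) /\
     (simp_iso (bier K) (cube_nerve m.-1) \/
      (3 <= m /\ simp_iso (bier K) (cubehex_nerve (m - 3))))).
Proof.
move=> m2 Kcx Knt; have ge := chi_bier_ge Kcx Knt.
split; first by rewrite ge chi_bier_le.
have m1 : m.-1.+1 = m by rewrite prednK // ltnW.
have m0 : 0 < m.-1 by rewrite -ltnS m1.
split=> [chiE|[_ isoE]]; last first.
  (* A colouring of the nerve with m - 1 colours is pulled back along the isomorphism. *)
  apply/eqP; rewrite eqn_leq ge andbT; apply: chi_min.
  case: isoE => [iso|[m3 iso]].
    exact: (simp_iso_colorable (bier_sub Kcx) iso (cube_colorable _)).
  have -> : m.-1 = (m - 3) + 2 by rewrite -subn1 -[in RHS](subnK m3) addnK -[in LHS](subnK m3) -addnBA.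
  exact: (simp_iso_colorable (bier_sub Kcx) iso (cubehex_colorable _)).
(* Polytopality follows from the isomorphism, since both nerves are polytopal. *)
suff isoE : simp_iso (bier K) (cube_nerve m.-1) \/
    (3 <= m /\ simp_iso (bier K) (cubehex_nerve (m - 3))).
  split=> //; case: isoE => [iso|[_ iso]]; apply: polytopal_iso iso _.
    exact: cube_polytopal.
  exact: cubehex_polytopal.
have := chi_colorable (bier K); rewrite chiE => /(colorableP (bier_sub Kcx))[c cP].
have := classification (@complex_sub _ _ Kcx) (complex0 Kcx) (complexT Kcx Knt)
  (edge_inl Kcx Knt cP) (edge_inr Kcx cP) (cofacet_pair Kcx Knt cP) (nonface_pair Kcx Knt cP).
case=> [[z KP]|[z [w [zw KP]]]|[a [b [ab KP]]]|[a [b [d [ab bd ad KP]]]]].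
- by left; exact: bier_avoid1_iso KP.
- by left; exact: bier_avoid2_iso KP.
- by left; exact: bier_notboth_iso KP.
- by right; exact: bier_atmost1_iso KP.
Qed.
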